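(* Let $n\ge 2$ be an integer and let $G$ be isomorphic to the dicyclic group $Q_{4n}=\langle x,y : x^{2n}=y^4=1,\ x^n=y^2,\ y^{-1}xy=x^{-1}\rangle$ of order $4n$. Then the signless Laplacian spectrum of the non-commuting graph $\Gamma_G$ is $$\left\{(4n-4)^n,\ (2n)^{2n-3},\ (4n-6)^{n-1},\ \left(4n-3+\sqrt{8n^2-16n+9}\right)^1,\ \left(4n-3-\sqrt{8n^2-16n+9}\right)^1\right\}$$ and its signless Laplacian energy is $$LE^+(\Gamma_G)=\begin{cases}\frac{4n^3-8n^2+6}{2n-1}+2\sqrt{8n^2-16n+9}, & \text{if } n\le 4,\\[2pt] \frac{8n^3-32n^2+32n-6}{2n-1}+2\sqrt{8n^2-16n+9}, & \text{if } n\ge 5.\end{cases}$$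
   Context: For a finite non-abelian group $G$ with center $Z(G)$, the non-commuting graph $\Gamma_G$ is the simple undirected graph with vertex set $G\setminus Z(G)$ in which $x,y$ are adjacent iff $xy\ne yx$. For a finite simple graph $\mathcal G$ with vertex set $v(\mathcal G)$, edge set $e(\mathcal G)$, adjacency matrix $A(\mathcal G)$ and diagonal degree matrix $D(\mathcal G)$, the signless Laplacian matrix is $Q(\mathcal G)=D(\mathcal G)+A(\mathcal G)$, and its signless Laplacian spectrum is the multiset of eigenvalues of $Q(\mathcal G)$. The notation $\{(\gamma_1)^{d_1},\dots,(\gamma_l)^{d_l}\}$ means the multiset in which $\gamma_r$ is listed $d_r$ times (coinciding listed values have their multiplicities added). The signless Laplacian energy is $LE^+(\mathcal G)=\sum_{\gamma}\left|\gamma-\frac{2|e(\mathcal G)|}{|v(\mathcal G)|}\right|$, the sum being over the signless Laplacian spectrum with multiplicity. *)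

(* Defs.v *)
From HB Require Import structures.
From mathcomp Require Import all_boot all_order all_algebra all_fingroup all_solvable.
From mathcomp Require Import polyrcf.

Set Implicit Arguments.
Unset Strict Implicit.
Unset Printing Implicit Defensive.

Import Order.TTheory GRing.Theory Num.Theory.

Record sgraph := SGraph {
  vertex :> finType;
  adj : rel vertex;
  adj_sym : symmetric adj;
  adj_irrefl : irreflexive adj
}.

Definition edges (g : sgraph) : {set {set g}} :=
  [set [set p.1; p.2] | p : g * g & adj p.1 p.2].

Definition degree (g : sgraph) (u : g) : nat := #|[set v : g | adj u v]|.

Section NonCommutingGraph.
Variables (gT : finGroupType) (G : {group gT}).

Definition noncentral := {x : gT | x \in (G :\: 'Z(G))%g}.

Definition noncommuting : rel noncentral :=
  fun x y => (val x * val y != val y * val x)%g.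

Fact noncommuting_sym : symmetric noncommuting.
Proof. by move=> x y; rewrite /noncommuting eq_sym. Qed.

Fact noncommuting_irrefl : irreflexive noncommuting.
Proof. by move=> x; rewrite /noncommuting eqxx. Qed.

Definition noncommuting_graph : sgraph :=
  SGraph noncommuting_sym noncommuting_irrefl.

End NonCommutingGraph.

Local Open Scope ring_scope.

Section SignlessLaplacian.
Variables (R : rcfType) (g : sgraph).

Definition adjacency_mx : 'M[R]_#|g| :=
  \matrix_(i, j) (adj (enum_val i) (enum_val j))%:R.

Definition degree_mx : 'M[R]_#|g| :=
  diag_mx (\row_i (degree (enum_val i))%:R).

Definition signless_laplacian : 'M[R]_#|g| := degree_mx + adjacency_mx.

End SignlessLaplacian.

(* The multiset of eigenvalues lying in R, with algebraic multiplicity, as a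
   sequence to be compared up to [perm_eq]; [rootsR] lists the distinct roots.
   For a symmetric matrix no eigenvalue is missed, as R is real closed. *)
Definition spectrum (R : rcfType) (n : nat) (M : 'M[R]_n) : seq R :=
  flatten [seq nseq (mup a (char_poly M)) a | a <- rootsR (char_poly M)].

Definition signless_laplacian_spectrum (R : rcfType) (g : sgraph) : seq R :=
  spectrum (signless_laplacian R g).

Definition signless_laplacian_energy (R : rcfType) (g : sgraph) : R :=
  \sum_(a <- signless_laplacian_spectrum R g)
    `|a - 2%:R * #|edges g|%:R / #|g|%:R|.

(* Main.v *)
(* Commuting is an equivalence relation on the noncentral elements of [Q_4n]: its
   classes are the [2n - 2] noncentral powers of [x], and the [n] pairs
   [{x^i y, x^(i+n) y}]. Hence the graph is complete multipartite with parts of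
   sizes [2n-2, 2, ..., 2]. If a complete multipartite graph on [m] vertices has
   parts of sizes [s_c], Sylvester's identity [det (1 + AB) = det (1 + BA)] used
   twice gives the characteristic polynomial of the signless Laplacian,
   [prod_c (X - m + s_c)^(s_c - 1) * prod_c w_c * (1 - sum_c s_c / w_c)] with
   [w_c = X - m + 2 s_c], which here splits into the announced factors.
   That [x^i y^j] really takes [4n] values is seen on a permutation group. *)
Require Import Defs.
From mathcomp Require Import all_boot all_order all_algebra all_fingroup all_solvable.
From mathcomp Require Import polyrcf fraction.
From mathcomp Require Import ring lra zify.
Set Implicit Arguments.
Unset Strict Implicit.
Unset Printing Implicit Defensive.

Import Order.TTheory GRing.Theory Num.Theory.
Local Open Scope ring_scope.

(** * Determinants of rank-one and multipartite perturbations of diagonal matrices *)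

(** Both sides are the determinant of the block matrix with rows [1, - A] and [B, 1], factored into
    block triangular matrices in two ways. *)
Lemma det_1addmulC (R : comNzRingType) m n (A : 'M[R]_(m, n)) (B : 'M_(n, m)) :
  \det (1%:M + A *m B) = \det (1%:M + B *m A).
Proof.
have eqM : block_mx 1%:M (- A) 0 1%:M *m block_mx (1%:M + A *m B) 0 B 1%:M
  = block_mx 1%:M 0 B 1%:M *m block_mx 1%:M (- A) 0 (1%:M + B *m A).
  by rewrite !mulmx_block !(mul0mx, mulmx0, mul1mx, mulmx1, mulNmx, mulmxN,
    addr0, add0r, addrK) addrC addrK.
have := congr1 determinant eqM.
by rewrite !det_mulmx !det_ublock !det_lblock !det1 !(mul1r, mulr1).
Qed.

(** Once [diag_mx w] is factored out, Sylvester's identity turns the rest, [1] plus a column times a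
    row, into a 1 by 1 determinant. *)
Lemma det_diag_sub_rank1 (F : fieldType) k (w s : 'rV[F]_k) :
  (forall c, w 0 c != 0) ->
  \det (diag_mx w - const_mx 1 *m s) =
  (\prod_c w 0 c) * (1 - \sum_c s 0 c / w 0 c).
Proof.
move=> w0; pose v := \row_c (w 0 c)^-1.
have wv : diag_mx w *m diag_mx v = 1%:M.
  apply/matrixP=> i j; rewrite mul_diag_mx !mxE mulrnAr.
  by case: eqP => [->|]; rewrite ?mulfV.
have -> : diag_mx w - const_mx 1 *m s =
    diag_mx w *m (1%:M + (diag_mx v *m const_mx (- 1)) *m s).
  rewrite mulmxDr mulmx1 !mulmxA wv mul1mx -mulNmx.
  by congr (_ + _ *m _); apply/matrixP=> i j; rewrite !mxE.
rewrite det_mulmx det_diag det_1addmulC; congr (_ * _).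
rewrite det_mx11 !mxE /= -sumrN; congr (_ + _); apply: eq_bigr => c _.
by rewrite mul_diag_mx !mxE mulrN1 mulrN.
Qed.

(* The matrix is [E + C K C^T], with [C] the class indicator matrix and
   [K = 1 - J]; Sylvester's identity reduces it to a matrix over the classes. *)
Lemma det_diag_sub_multipartite (F : fieldType) m k (f : 'I_m -> 'I_k)
    (e : 'I_k -> F) (s := fun c => #|[set i | f i == c]|) :
  (forall c, 0 < s c)%N -> (forall c, e c != 0) -> (forall c, e c + (s c)%:R != 0) ->
  \det (\matrix_(i, j) (e (f i) *+ (i == j) - (f i != f j)%:R)) =
  (\prod_c e c ^+ (s c).-1) *
  ((\prod_c (e c + (s c)%:R)) * (1 - \sum_c (s c)%:R / (e c + (s c)%:R))).
Proof.
move=> s_gt0 e0 w0.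
pose C : 'M[F]_(m, k) := \matrix_(i, c) (f i == c)%:R.
pose K : 'M[F]_k := 1%:M - const_mx 1.
pose E : 'rV[F]_m := \row_i e (f i); pose V : 'rV[F]_m := \row_i (e (f i))^-1.
have CX n (X : 'M[F]_(k, n)) i j : (C *m X) i j = X (f i) j.
  rewrite mxE (bigD1 (f i)) //= mxE eqxx mul1r big1 ?addr0 // => c.
  by rewrite eq_sym => /negPf nc; rewrite mxE nc mul0r.
have XC n (X : 'M[F]_(n, k)) i j : (X *m C^T) i j = X i (f j).
  rewrite mxE (bigD1 (f j)) //= !mxE eqxx mulr1 big1 ?addr0 // => c.
  by rewrite eq_sym => /negPf nc; rewrite !mxE nc mulr0.
have EV : diag_mx E *m diag_mx V = 1%:M.
  apply/matrixP=> i j; rewrite mul_diag_mx !mxE mulrnAr.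
  by case: eqP => [->|]; rewrite ?mulfV.
have -> : \matrix_(i, j) (e (f i) *+ (i == j) - (f i != f j)%:R) =
    diag_mx E *m (1%:M + (diag_mx V *m C) *m (K *m C^T)).
  rewrite mulmxDr mulmx1 !mulmxA EV mul1mx.
  apply/matrixP=> i j; rewrite [RHS]mxE XC CX !mxE.
  by case: (f i == f j); rewrite /= ?subrr ?subr0 ?addr0 ?sub0r.
rewrite det_mulmx det_1addmulC det_diag.
(* Each class contributes [e c ^+ s c]; one factor [e c] per class is set aside for the determinant
   over the classes. *)
have -> : \prod_i E 0 i = (\prod_c e c ^+ (s c).-1) * \prod_c e c.
  rewrite -big_split /= (partition_big f predT) //=; apply: eq_bigr => c _.
  rewrite -exprSr prednK //.
  transitivity (\prod_(i in [set i | f i == c]) e c); last by rewrite prodr_const.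
  apply: eq_big => [i|i /eqP <-]; last by rewrite mxE.
  by rewrite inE.
rewrite -mulrA; congr (_ * _).
have -> : K *m C^T *m (diag_mx V *m C) = K *m diag_mx (\row_c ((s c)%:R / e c)).
  rewrite -mulmxA; congr (_ *m _); apply/matrixP=> a b.
  rewrite !mxE; under eq_bigr => i _ do rewrite mul_diag_mx !mxE.
  have [->|ab] := eqVneq a b; last first.
    rewrite mulr0n; apply: big1 => i _.
    by have [->|_] := eqVneq (f i) a; rewrite ?(negPf ab) ?mulr0 ?mul0r.
  transitivity (\sum_(i in [set i | f i == b]) (e b)^-1); last first.
    by rewrite sumr_const mulr1n mulr_natl.
  rewrite [RHS]big_mkcond; apply: eq_bigr => i _ /=.
  by rewrite inE; case: eqP => [->|]; rewrite ?mul0r // mulr1 mul1r.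
(* Right multiplication by the diagonal matrix of [e] clears the denominators: [1 + K diag(s / e)]
   becomes [diag(e + s)] minus a column of ones times [s], a rank-one perturbation. *)
have -> : \prod_c e c = \det (diag_mx (\row_c e c)).
  by rewrite det_diag; apply: eq_bigr => c _; rewrite mxE.
rewrite mulrC -det_mulmx mulmxDl mul1mx -mulmxA.
have -> : \prod_c (e c + (s c)%:R) = \prod_c (\row_c (e c + (s c)%:R)) 0 c.
  by apply: eq_bigr => c _; rewrite mxE.
have -> : \sum_c (s c)%:R / (e c + (s c)%:R) =
   \sum_c (\row_c (s c)%:R) 0 c / (\row_c (e c + (s c)%:R)) 0 c.
  by apply: eq_bigr => c _; rewrite !mxE.
rewrite -det_diag_sub_rank1; last by move=> c; rewrite mxE.
congr (\det _).
have -> : diag_mx (\row_c ((s c)%:R / e c)) *m diag_mx (\row_c e c) =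
   diag_mx (\row_c (s c)%:R).
  apply/matrixP=> i j; rewrite mul_diag_mx !mxE mulrnAr.
  by case: eqP => [->|]; rewrite ?divfK.
apply/matrixP=> a b; rewrite mulmxBl mul1mx !mxE addrA -mulrnDl.
rewrite big_ord_recl big_ord0 addr0 !mxE mul1r; congr (_ - _).
rewrite (bigD1 b) //= !mxE eqxx mul1r mulr1n big1 ?addr0 // => c.
by move=> /negPf nc; rewrite !mxE nc mulr0.
Qed.

(** * Spectra, edge counts and characteristic polynomials of multipartite graphs *)

(** At every [x] both lists count the multiplicity of [x] as a root of the characteristic
    polynomial. *)
Lemma spectrumE (R : rcfType) n (M : 'M[R]_n) (s : seq R) :
  char_poly M = \prod_(a <- s) ('X - a%:P) -> perm_eq (spectrum M) s.
Proof.
move=> pE; have p0 : char_poly M != 0 by rewrite monic_neq0 ?char_poly_monic.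
apply/allP=> x _ /=; apply/eqP.
rewrite /spectrum count_flatten -map_comp.
rewrite (eq_map (_ : _ =1 fun a => (a == x) * mup a (char_poly M))%N); last first.
  by move=> a /=; rewrite count_nseq.
have -> : count_mem x s = mup x (char_poly M) by rewrite pE mu_prod_XsubC.
have sumE (r : seq R) : uniq r -> sumn [seq (a == x) * mup a (char_poly M) | a <- r]%N
   = ((x \in r) * mup x (char_poly M))%N.
  elim: r => //= a r IH /andP[ar ur]; rewrite IH // inE.
  have [<-|_] := eqVneq a x; first by rewrite (negPf ar) addn0.
  by rewrite mul0n.
rewrite sumE; last exact: uniq_roots.
rewrite -roots_on_rootsR // inE /=.
have [//|nr] := boolP (root _ x); first by rewrite mul1n.
by rewrite mupNroot.
Qed.

(** Double counting of ordered adjacent pairs: grouped by first entry they give the degrees, and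
    each edge comes from exactly two pairs, distinct because adjacency is irreflexive. *)
Lemma handshake (g : sgraph) : (2 * #|edges g| = \sum_(u : g) degree u)%N.
Proof.
pose A := [set p : g * g | adj p.1 p.2].
pose h (p : g * g) : {set g} := [set p.1; p.2].
have -> : (\sum_(u : g) degree u = #|A|)%N.
  rewrite -sum1_card (eq_bigl (fun p => true && adj p.1 p.2)); last first.
    by move=> p; rewrite inE.
  rewrite -(pair_big_dep predT (fun u v => adj u v) (fun _ _ => 1%N)) /=.
  apply: eq_bigr => u _; rewrite /degree -sum1_card.
  by apply: eq_bigl => v; rewrite inE.
rewrite -[RHS]sum1_card (partition_big_imset h) /=.
rewrite -[edges g]/(h @: A).
rewrite mulnC -sum_nat_const; apply: eq_bigr => e /imsetP[[u v]].
rewrite inE /= => uv ->.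
have ne : u != v by apply: contraTneq uv => ->; rewrite adj_irrefl.
rewrite (eq_bigl (mem [set (u, v); (v, u)])) ?sum1_card ?cards2 ?xpair_eqE ?negb_and ?ne //.
move=> [a b]; rewrite !inE /= !xpair_eqE; apply/andP/orP.
  move=> [ab /eqP habE].
  have : a != b by apply: contraTneq ab => ->; rewrite adj_irrefl.
  have /set2P[->|->] : a \in [set u; v] by rewrite -[[set u; v]]habE set21.
    have /set2P[->|->] : b \in [set u; v] by rewrite -[[set u; v]]habE set22.
      by rewrite eqxx.
    by rewrite !eqxx; left.
  have /set2P[->|->] : b \in [set u; v] by rewrite -[[set u; v]]habE set22.
    by rewrite !eqxx; right.
  by rewrite eqxx.
by move=> [] /andP[/eqP-> /eqP->]; rewrite /h /= ?eqxx // setUC eqxx adj_sym.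
Qed.

Lemma degree_multipartite (g : sgraph) (K : eqType) (f : g -> K) (u : g) :
  (forall u v : g, adj u v = (f u != f v)) ->
  degree u = (#|g| - #|[set v | f v == f u]|)%N.
Proof.
move=> adjE; rewrite /degree cardsCs; congr (_ - _)%N; apply: eq_card => v.
by rewrite !inE adjE negbK eq_sym.
Qed.

(* Vertices of the class [c] have degree [#|g| - s c]; the determinant is computed
   over rational fractions, where the polynomials [w c] become invertible. *)
Lemma char_poly_multipartite (R : rcfType) (g : sgraph) k (f : g -> 'I_k)
    (s := fun c => #|[set u | f u == c]|)
    (w := fun c => 'X - (#|g|%:R - 2%:R * (s c)%:R)%:P : {poly R}) :
  (forall u v : g, adj u v = (f u != f v)) -> (forall c, 0 < s c)%N ->
  char_poly (signless_laplacian R g) =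
  (\prod_c ('X - (#|g|%:R - (s c)%:R)%:P) ^+ (s c).-1) *
  (\prod_c w c - \sum_c (s c)%:R * \prod_(d | d != c) w d).
Proof.
move=> adjE s_gt0.
pose iota : {rmorphism {poly R} -> {fraction {poly R}}} := @FracField.tofrac _.
have iota_inj : injective iota by move=> p q /eqP; rewrite tofrac_eq => /eqP.
have iota0 p : (iota p == 0) = (p == 0) := tofrac_eq0 p.
apply: iota_inj.
(* [e c] is [X] minus the degree of a vertex of class [c]; adding [s c] to it gives [w c]. *)
pose e c : {fraction {poly R}} := iota ('X - (#|g|%:R - (s c)%:R)%:P).
have eD c : e c + (s c)%:R = iota (w c).
  rewrite /e /w -(rmorph_nat iota) -rmorphD; congr (tofrac _).
  by rewrite !polyCB polyCM !polyC_natr; ring.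
have degE u := degree_multipartite u adjE.
have s_le c : (s c <= #|g|)%N by apply: max_card.
pose f' (i : 'I_#|g|) := f (enum_val i).
have sE c : #|[set i | f' i == c]| = s c.
  rewrite -(card_imset _ enum_val_inj); apply: eq_card => u.
  rewrite inE; apply/imsetP/eqP => [[i]|<-].
    by rewrite inE => /eqP <- ->.
  by exists (enum_rank u); rewrite ?inE /f' enum_rankK.
rewrite /char_poly -det_map_mx.
have -> : map_mx (iota) (char_poly_mx (signless_laplacian R g)) =
  \matrix_(i, j) (e (f' i) *+ (i == j) - (f' i != f' j)%:R).
  apply/matrixP=> i j; rewrite !mxE adjE degE -/(s _) natrB // /e /f'.
  rewrite polyCD polyCMn polyC_natr opprD addrA rmorphB rmorph_nat.
  by case: eqP => [->|_]; rewrite /= ?mulr1n // !mulr0n subr0 rmorph0.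
rewrite det_diag_sub_multipartite.
- rewrite rmorphM rmorph_prod; congr (_ * _).
    by apply: eq_bigr => c _; rewrite sE rmorphXn.
  (* Distributing the product of the [w c] over [1 - sum_c s_c / w_c] cancels every denominator. *)
  rewrite mulrBr mulr1 rmorphB rmorph_prod rmorph_sum; congr (_ - _).
    by apply: eq_bigr => c _; rewrite sE eD.
  rewrite mulr_sumr; apply: eq_bigr => c _.
  rewrite !sE eD rmorphM rmorph_nat rmorph_prod (bigD1 c) //= sE eD.
  rewrite mulrCA mulrAC divff ?iota0 ?polyXsubC_eq0 // mul1r.
  by congr (_ * _); apply: eq_bigr => d _; rewrite sE eD.
- by move=> c; rewrite sE.
- by move=> c; rewrite /e iota0 polyXsubC_eq0.
by move=> c; rewrite sE eD iota0 polyXsubC_eq0.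
Qed.

Lemma sum_const_nseq (V : zmodType) (T : Type) (F : T -> V) n x :
  \sum_(a <- nseq n x) F a = F x *+ n.
Proof. by rewrite big_nseq iter_addr_0. Qed.

Lemma prod_const_nseq (A : comNzRingType) (T : Type) (F : T -> A) n x :
  \prod_(a <- nseq n x) F a = F x ^+ n.
Proof. by rewrite big_nseq iter_mulr_1. Qed.

(** * Spectrum and energy of a complete multipartite graph with parts of sizes 2n-2, 2, ..., 2 *)

Section DicyclicSpectrum.

Variables (R : rcfType) (n : nat) (g : sgraph) (f : g -> 'I_n.+1).
Hypotheses (n_gt1 : (1 < n)%N) (adjE : forall u v : g, adj u v = (f u != f v)).
Hypothesis card0 : #|[set u | f u == ord0]| = (2 * n - 2)%N.
Hypothesis card_lift : forall c, #|[set u | f u == lift ord0 c]| = 2%N.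

Let N : R := n%:R.
Let r : R := Num.sqrt (8 * N ^+ 2 - 16 * N + 9).

Lemma sum_over_classes (F : 'I_n.+1 -> nat) :
  (\sum_(u : g) F (f u) = (2 * n - 2) * F ord0 + \sum_(c < n) 2 * F (lift ord0 c))%N.
Proof.
rewrite (partition_big f predT) //= big_ord_recl.
have E c : (\sum_(u | f u == c) F (f u) = #|[set u | f u == c]| * F c)%N.
  by rewrite -sum_nat_const; apply: eq_big => u; rewrite ?inE // => /eqP ->.
by rewrite E card0; congr (_ + _)%N; apply: eq_bigr => c _; rewrite E card_lift.
Qed.

Lemma card_dicyclic_graph : #|g| = (4 * n - 2)%N.
Proof.
rewrite -sum1_card (sum_over_classes (fun=> 1%N)) sum_nat_const card_ord; lia.
Qed.

(** The 2n-2 vertices of the large part have degree 2n, the 2n others have degree 4n-4. *)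
Lemma double_card_edges : (2 * #|edges g| = 12 * n * (n - 1))%N.
Proof.
rewrite handshake; pose F c := (#|g| - #|[set u | f u == c]|)%N.
rewrite (eq_bigr (fun u => F (f u))) => [|u _]; last exact: degree_multipartite.
rewrite sum_over_classes /F card_dicyclic_graph card0.
under eq_bigr => c _ do rewrite card_lift.
rewrite sum_nat_const card_ord; nia.
Qed.

Lemma sqr_r : r ^+ 2 = 8 * N ^+ 2 - 16 * N + 9.
Proof.
rewrite sqr_sqrtr // (_ : _ + 9 = 8 * (N - 1) ^+ 2 + 1); last by ring.
by rewrite addr_ge0 // mulr_ge0 ?sqr_ge0.
Qed.

(** Here [w] is X-2 for the large part and [w1] = X-4n+6 for each pair. The last factor of the
    characteristic polynomial is [w1 ^+ (n - 1)] times (X-2n)(X-4n+6) - 2n(X-2) = (X-4n+3)^2 -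
    (8n^2-16n+9), whose roots are the two irrational-looking eigenvalues. *)
Lemma dicyclic_spectrum :
  perm_eq (signless_laplacian_spectrum R g)
    (nseq n (4 * N - 4) ++ nseq (2 * n - 3) (2 * N) ++ nseq (n - 1) (4 * N - 6)
       ++ nseq 1 (4 * N - 3 + r) ++ nseq 1 (4 * N - 3 - r)).
Proof.
apply: spectrumE; rewrite (char_poly_multipartite R adjE); last first.
  by move=> c; case: (unliftP ord0 c) => [d|] ->; rewrite ?card0 ?card_lift; lia.
rewrite !big_cat /= !prod_const_nseq !big_seq1 !big_ord_recl card0 card_dicyclic_graph.
have gE : (4 * n - 2)%:R = 4 * N - 2 :> R by rewrite natrB ?natrM //; lia.
have s0E : (2 * n - 2)%:R = 2 * N - 2 :> R by rewrite natrB ?natrM //; lia.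
set w1 := 'X - (4 * N - 6)%:P.
have wE : 'X - ((4 * n - 2)%:R - 2%:R * 2%:R)%:P = w1.
  by rewrite gE /w1; congr (_ - _%:P); ring.
have w0E : 'X - ((4 * n - 2)%:R - 2%:R * (2 * n - 2)%:R)%:P = 'X - 2%:P :> {poly R}.
  by rewrite gE s0E; congr (_ - _%:P); ring.
have -> : \prod_(c < n) ('X - ((4 * n - 2)%:R - #|[set u | f u == lift ord0 c]|%:R)%:P)
     ^+ #|[set u | f u == lift ord0 c]|.-1 = ('X - (4 * N - 4)%:P) ^+ n.
  under eq_bigr => c _ do rewrite card_lift gE expr1.
  rewrite prodr_const card_ord; congr (('X - _%:P) ^+ n); ring.
have -> : \prod_(c < n) ('X - ((4 * n - 2)%:R -
    2%:R * #|[set u | f u == lift ord0 c]|%:R)%:P) = w1 ^+ n.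
  under eq_bigr => c _ do rewrite card_lift wE.
  by rewrite prodr_const card_ord.
rewrite w0E.
have -> : \prod_(d | d != ord0) ('X - ((4 * n - 2)%:R -
    2%:R * #|[set u | f u == d]|%:R)%:P) = w1 ^+ n.
  rewrite big_mkcond big_ord_recl eqxx /= mul1r.
  under eq_bigr => c _ do rewrite card_lift wE.
  by rewrite prodr_const card_ord.
have wlift c : \prod_(d | d != lift ord0 c)
   ('X - ((4 * n - 2)%:R - 2%:R * #|[set u | f u == d]|%:R)%:P) = ('X - 2%:P) * w1 ^+ n.-1.
  rewrite big_mkcond big_ord_recl /= card0 w0E; congr (_ * _).
  under eq_bigr => d _ do rewrite card_lift wE (inj_eq lift_inj).
  by rewrite -big_mkcond prodr_const cardC1 card_ord.
rewrite [\sum_(c < n) _](eq_bigr (fun=> 2%:R * (('X - 2%:P) * w1 ^+ n.-1))); last first.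
  by move=> c _; rewrite card_lift wlift.
rewrite sumr_const card_ord -!subn1 -subnDA.
have -> : 'X - ((4 * n - 2)%:R - (2 * n - 2)%:R)%:P = 'X - (2 * N)%:P :> {poly R}.
  by rewrite gE s0E; congr (_ - _%:P); ring.
rewrite [X in X * _]mulrC -!mulrA; congr (_ * (_ * _)).
have -> : w1 ^+ n = w1 * w1 ^+ (n - 1) by rewrite -exprS subn1 prednK //; lia.
(* To [ring], [r] is an atom, so its square is supplied as a polynomial identity. *)
have rE : (r%:P) ^+ 2 = 8 * N%:P ^+ 2 - 16 * N%:P + 9 :> {poly R}.
  by rewrite -polyC_exp sqr_r !(polyCD, polyCN, polyCM) !polyC_natr; ring.
have s0E' : (2 * n - 2)%:R = 2 * N%:P - 2 :> {poly R}.
  by rewrite -[LHS]polyC_natr s0E !(polyCD, polyCN, polyCM) !polyC_natr.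
have nE : n%:R = N%:P :> {poly R} by rewrite polyC_natr.
rewrite -[_ *+ n]mulr_natr nE s0E' /w1 !(polyCD, polyCN, polyCM) !polyC_natr.
set W := _ ^+ (n - 1).
rewrite [RHS](_ : _ = W * (('X - 4 * N%:P + 3) ^+ 2 - (r%:P) ^+ 2)); last by ring.
rewrite rE; ring.
Qed.

(** The average [m] is 6n(n-1)/(2n-1). Among the distances to it, only that of 4n-6 has a sign
    depending on n, which causes the two cases. *)
Lemma dicyclic_energy : signless_laplacian_energy R g =
  if (n <= 4)%N
  then (4 * N ^+ 3 - 8 * N ^+ 2 + 6) / (2 * N - 1) + 2 * r
  else (8 * N ^+ 3 - 32 * N ^+ 2 + 32 * N - 6) / (2 * N - 1) + 2 * r.
Proof.
rewrite /signless_laplacian_energy (perm_big _ dicyclic_spectrum).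
rewrite !big_cat /= !sum_const_nseq !big_seq1.
have N_ge2 : 2 <= N by rewrite ler_nat.
have d_gt0 : 0 < 2 * N - 1 by lra.
have d0 : 2 * N - 1 != 0 by rewrite gt_eqF.
have -> : 2%:R * #|edges g|%:R / #|g|%:R = 6 * N * (N - 1) / (2 * N - 1) :> R.
  rewrite -natrM double_card_edges card_dicyclic_graph !natrB; try lia.
  rewrite !natrM natrB; last lia.
  by rewrite -/N; field; rewrite d0 /=; apply/eqP; lra.
set m := 6 * N * (N - 1) / (2 * N - 1).
have E1 : `|4 * N - 4 - m| = (N - 1) * (2 * N - 4) / (2 * N - 1).
  rewrite ger0_norm; first by rewrite /m; field.
  rewrite (_ : _ - m = (N - 1) * (2 * N - 4) / (2 * N - 1)); last by rewrite /m; field.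
  by rewrite divr_ge0 ?mulr_ge0 //; lra.
have E2 : `|2 * N - m| = 2 * N * (N - 2) / (2 * N - 1).
  rewrite ler0_norm; first by rewrite /m; field.
  rewrite (_ : _ - m = - (2 * N * (N - 2) / (2 * N - 1))); last by rewrite /m; field.
  by rewrite oppr_le0 divr_ge0 ?mulr_ge0 //; lra.
have E3 : 4 * N - 6 - m = (2 * N ^+ 2 - 10 * N + 6) / (2 * N - 1).
  by rewrite /m; field.
pose t := (2 * N ^+ 2 - 4 * N + 3) / (2 * N - 1).
(* The last two eigenvalues lie at [t + r] and [t - r] from the average; since [0 <= t <= r], their
   distances add up to [2 * r]. *)
have tE : 4 * N - 3 - m = t by rewrite /m /t; field.
have t_ge0 : 0 <= t by rewrite divr_ge0 //; nra.
have t_le_r : t <= r.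
  rewrite ler_pdivrMr // -ler_sqr ?nnegrE; first last.
  - by rewrite mulr_ge0 ?sqrtr_ge0 //; lra.
  - by nra.
  rewrite exprMn sqr_r; nra.
have -> : `|4 * N - 3 + r - m| = t + r.
  by rewrite addrAC tE ger0_norm // addr_ge0 ?sqrtr_ge0.
have -> : `|4 * N - 3 - r - m| = r - t.
  by rewrite addrAC tE ler0_norm ?opprB // subr_le0.
rewrite E1 E2 E3 normrM [`|_^-1|]ger0_norm ?invr_ge0 ?ltW //.
rewrite -[_ *+ n]mulr_natr -[_ *+ (2 * n - 3)]mulr_natr -[_ *+ (n - 1)]mulr_natr.
rewrite !natrB ?natrM -/N; try lia.
(* 2n^2-10n+6 is negative for n = 2, 3, 4 and positive from n = 5 on. *)
case: leqP => n4.
  have N4 : N <= 4 by rewrite ler_nat.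
  by rewrite ler0_norm; [field | nra].
have N5 : 5 <= N by rewrite ler_nat.
by rewrite ger0_norm; [field | nra].
Qed.

End DicyclicSpectrum.

(** * A permutation group bounding the order of the dicyclic group from below *)

Local Open Scope group_scope.

(* Right regular representation on the normal forms [x ^+ i * y ^+ b]. *)
Lemma dicyclic_perm_model n : (1 < n)%N ->
  exists H : {group {perm 'Z_(2 * n) * bool}},
    (H \homg Grp (x : y : x ^+ (2 * n) = y ^+ 4 = 1, x ^+ n = y ^+ 2,
             y^-1 * x * y = x^-1)) /\ (4 * n <= #|H|)%N.
Proof.
move=> n_gt1; pose T := ('Z_(2 * n) * bool)%type.
have n20 : ((2 * n)%:R = 0 :> 'Z_(2 * n))%R by rewrite pchar_Zp //; lia.
have nn0 : (n%:R + n%:R = 0 :> 'Z_(2 * n))%R by rewrite -natrD addnn -mul2n.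
(* The point [(i, b)] stands for x^i y^b. The sign in [fx] comes from y x = x^-1 y, the shift by n
   in [fy] from y^2 = x^n. *)
pose fx (p : T) : T := ((if p.2 then p.1 - 1 else p.1 + 1)%R, p.2).
pose fy (p : T) : T := ((if p.2 then p.1 + n%:R else p.1)%R, ~~ p.2).
have fx_inj : injective fx.
  by move=> [i []] [j []] // /(congr1 fst) /= /addIr ->.
have fy_inj : injective fy.
  by move=> [i []] [j []] // /(congr1 fst) /= => [/addIr|] ->.
pose x := perm fx_inj; pose y := perm fy_inj.
have xX k i b : (x ^+ k) (i, b) = ((if b then i - k%:R else i + k%:R)%R, b).
  elim: k => [|k IH]; first by rewrite perm1 subr0 addr0; case: b.
  rewrite expgSr permM IH permE /fx /= -natr1.
  by case: b {IH} => /=; congr (_, _); ring.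
have y2 p : (y ^+ 2) p = (p.1 + n%:R, p.2)%R.
  by rewrite expgS expg1 permM !permE /fy; case: p => i [] /=.
exists (<[x]> <*> <[y]>)%G; split.
  apply/existsP; exists (x, y); rewrite /= !xpair_eqE eqxx /=.
  apply/and4P; split.
  - apply/eqP/permP => -[i b]; rewrite xX perm1 n20.
    by rewrite subr0 addr0; case: b.
  - apply/eqP/permP => p.
    rewrite (expgM y 2 2) expgS expg1 permM !y2 perm1 /= -addrA nn0 addr0.
    by rewrite -surjective_pairing.
  - apply/eqP/permP => -[i b]; rewrite xX y2 /=; case: b => //.
    by congr (_, _); rewrite -[(- _)%R]add0r -nn0 addrK.
  (* The last relation is checked in the inverse-free form x y x = y. *)
  apply/eqP/(mulgI y)/(mulIg x); rewrite !mulgA mulgV mul1g mulgKV.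
  apply/permP => -[i b]; rewrite !permM !permE /fy /fx /=.
  by case: b => /=; congr (_, _); ring.
set H := (_ <*> _)%G.
have Hx k : x ^+ k \in H by rewrite groupX // mem_gen // inE cycle_id.
have Hy : y \in H by rewrite mem_gen // inE cycle_id orbT.
have -> : (4 * n)%N = #|{: 'Z_(2 * n) * bool}|.
  by rewrite card_prod card_bool card_ord Zp_cast; lia.
(* Evaluation at [(0, false)] maps [H] onto all 4n points, since x^i y^b sends this point to
   [(i, b)]. *)
apply: leq_trans (leq_imset_card (fun h : {perm T} => h (0%R, false)) H).
apply/subset_leq_card/subsetP => -[i b] _; apply/imsetP.
exists (x ^+ (i : nat) * y ^+ b); first by rewrite groupM // groupX.
rewrite permM xX add0r natr_Zp.
by case: b; rewrite ?expg1 ?expg0 ?perm1 // permE.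
Qed.

(** * Normal forms and commutation from the dicyclic relations *)

Lemma modn_add_leq m n : (m < 2 * n)%N -> (m %% n + n * (n <= m) = m)%N.
Proof.
case: (leqP n m) => [nm|lt_mn] m_lt; last by rewrite modn_small // muln0 addn0.
by rewrite -{1}(subnKC nm) modnDl modn_small; lia.
Qed.

Section DicyclicRelations.

Variables (gT : finGroupType) (n : nat) (x y : gT).
Hypotheses (n_gt1 : (1 < n)%N) (x2n : x ^+ (2 * n) = 1).
Hypotheses (xn : x ^+ n = y ^+ 2) (xJ : x ^ y = x^-1).

(** The exponent of [x], below 2n, is split into a residue modulo n and a bit because x^n is
    central: commutation does not see the bit. *)
Definition dicyclic_elt (p : 'I_n * bool * bool) : gT :=
  x ^+ (p.1.1 + n * p.1.2) * y ^+ p.2.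

(** As [y] normalizes the subgroup generated by [x], every element is some x^i y^j; the even part of
    j moves into the power of [x] through y^2 = x^n. *)
Lemma dicyclic_joinE :
  (<[x]> <*> <[y]>) \subset [set dicyclic_elt p | p : 'I_n * bool * bool].
Proof.
rewrite norm_joinEr; last first.
  by rewrite cycle_subG inE -cycleJ xJ cycleV.
apply/subsetP => _ /mulsgP[_ _ /cycleP[i ->] /cycleP[j ->] ->].
pose m := ((i + n * j./2) %% (2 * n))%N.
have m_lt : (m < 2 * n)%N by rewrite ltn_mod; lia.
have mn_lt : (m %% n < n)%N by rewrite ltn_mod; lia.
apply/imsetP; exists (Ordinal mn_lt, n <= m, odd j)%N => //.
rewrite /dicyclic_elt /=.
rewrite modn_add_leq //.
rewrite /m expg_mod // expgD expgM xn -expgM -mulgA -expgD.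
by rewrite mul2n addnC odd_double_half.
Qed.

Hypothesis card_ge : (4 * n <= #|<[x]> <*> <[y]>|)%N.

(** The 4n triples cover a group of at least 4n elements, so no two of them can collide. *)
Lemma dicyclic_elt_inj : injective dicyclic_elt.
Proof.
have /imset_injP inj : #|dicyclic_elt @: predT| == #|{: 'I_n * bool * bool}|.
  rewrite eqn_leq leq_imset_card !card_prod card_bool card_ord.
  have := subset_leq_card dicyclic_joinE; move: card_ge.
  by rewrite -mulnA mulnC; exact: leq_trans.
by move=> p q; apply: inj.
Qed.

(** The order divides 2n. A smaller order m would give x^m = x^0 two normal forms, and injectivity
    would force m = 0. *)
Lemma dicyclic_order : #[x] = (2 * n)%N.
Proof.
apply/eqP; rewrite eqn_leq dvdn_leq ?order_dvdn ?x2n //=; last lia.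
rewrite leqNgt; apply/negP => m_lt; set m := #[x] in m_lt.
have mn_lt : (m %% n < n)%N by rewrite ltn_mod; lia.
have n_gt0 : (0 < n)%N by lia.
have := @dicyclic_elt_inj (Ordinal mn_lt, n <= m, false)%N (Ordinal n_gt0, false, false).
rewrite /dicyclic_elt /=.
rewrite modn_add_leq //.
rewrite expg_order muln0 => /(_ erefl) [].
case: leqP => // nm; rewrite modn_small // => m0.
by have := order_gt0 x; rewrite -/m m0.
Qed.

Lemma expg_y_mulC i : y * x ^+ i = x ^- i * y.
Proof.
have : (x ^+ i) ^ y^-1 = x ^- i.
  rewrite conjXg -expgVn; congr (_ ^+ i); apply: invg_inj.
  by rewrite invgK -conjVg -xJ conjgK.
by rewrite conjgE invgK => <-; rewrite !mulgA mulgKV.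
Qed.

(** Squaring removes the bits since x^(2n) = 1, and the doubled exponents stay below the order 2n of
    [x]. *)
Lemma expg_double_eq i j : (i < n)%N -> (j < n)%N -> forall a b : bool,
  (x ^+ (i + n * a) * x ^+ (i + n * a) == x ^+ (j + n * b) * x ^+ (j + n * b)) = (i == j).
Proof.
move=> i_lt j_lt a b; rewrite -!expgD.
have E k (c : bool) : x ^+ (k + n * c + (k + n * c)) = x ^+ (2 * k).
  have -> : (k + n * c + (k + n * c) = 2 * n * c + 2 * k)%N by case: c; lia.
  by rewrite expgD expgM x2n expg1n mul1g.
rewrite !E eq_expg_mod_order dicyclic_order !modn_small; lia.
Qed.

(** Each case reduces to squares: a power c of [x] commutes with x^j y iff c^2 = 1, and c y commutes
    with d y iff c^2 = d^2. *)
Lemma dicyclic_commute p q :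
  (dicyclic_elt p * dicyclic_elt q == dicyclic_elt q * dicyclic_elt p) =
  match p.2, q.2 with
  | false, false => true
  | false, true => p.1.1 == 0%N :> nat
  | true, false => q.1.1 == 0%N :> nat
  | true, true => p.1.1 == q.1.1
  end.
Proof.
have xy i j (c := x ^+ i) : (c * (x ^+ j * y) == x ^+ j * y * c) = (c * c == 1).
  rewrite -[x ^+ j * y * c]mulgA expg_y_mulC !mulgA -expgD addnC expgD.
  rewrite (inj_eq (mulIg y)) (inj_eq (mulgI _)).
  by rewrite -(inj_eq (mulgI c)) mulgV.
have n_gt0 : (0 < n)%N by lia.
have xx0 (i : 'I_n) (a : bool) : (x ^+ (i + n * a) * x ^+ (i + n * a) == 1) = (i == 0%N :> nat).
  have := expg_double_eq (ltn_ord i) n_gt0 a false.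
  by rewrite muln0 expg0 mulg1.
case: p q => [[i a] []] [[j b] []]; rewrite /dicyclic_elt /= ?expg1 ?expg0 ?mulg1.
- rewrite -!mulgA !(mulgA y) !expg_y_mulC !mulgA !(inj_eq (mulIg y)).
  rewrite -val_eqE -(expg_double_eq (ltn_ord i) (ltn_ord j) a b).
  set c := x ^+ (i + _); set d := x ^+ (j + _).
  have cd : commute c d^-1 by apply/commuteV/commuteX2.
  rewrite -(inj_eq (mulIg c)) mulgKV -mulgA -cd mulgA.
  by rewrite -(inj_eq (mulIg d)) mulgKV.
- by rewrite eq_sym xy xx0.
- by rewrite xy xx0.
- by rewrite -!expgD addnC eqxx.
Qed.

(** False exactly on the triples of 1 and x^n. *)
Definition dicyclic_noncentral (p : 'I_n * bool * bool) := p.2 || (p.1.1 != 0%N :> nat).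

Definition dicyclic_class (p : 'I_n * bool * bool) : 'I_n.+1 :=
  if p.2 then lift ord0 p.1.1 else ord0.

Lemma card_dicyclic_class0 :
  #|[set p | dicyclic_noncentral p & dicyclic_class p == ord0]| = (2 * n - 2)%N.
Proof.
have n_gt0 : (0 < n)%N by lia.
transitivity #|setX (setX [set~ Ordinal n_gt0] [set: bool]) [set false]|.
  apply: eq_card => -[[i a] []]; rewrite !inE /= ?andbF //.
  by rewrite eqxx !andbT.
by rewrite !cardsX cards1 cardsC1 cardsT card_bool card_ord; lia.
Qed.

Lemma card_dicyclic_class_lift c :
  #|[set p | dicyclic_noncentral p & dicyclic_class p == lift ord0 c]| = 2%N.
Proof.
transitivity #|setX (setX [set c] [set: bool]) [set true]|.
  apply: eq_card => -[[i a] []]; rewrite !inE /= ?andbF //.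
  by rewrite (inj_eq lift_inj) !andbT.
by rewrite !cardsX !cards1 cardsT card_bool.
Qed.

(** The class of a vertex is read off its normal form, and the class sizes are counted on triples
    through this bijection. *)
Lemma dicyclic_multipartite (G : {group gT}) : <[x]> <*> <[y]> = G ->
  exists f : noncommuting_graph G -> 'I_n.+1,
  [/\ forall u v, adj u v = (f u != f v),
      #|[set u | f u == ord0]| = (2 * n - 2)%N &
      forall c, #|[set u | f u == lift ord0 c]| = 2%N].
Proof.
move=> defG.
have eltG p : dicyclic_elt p \in G.
  by rewrite -defG groupM // groupX // mem_gen // inE cycle_id ?orbT.
have [psi psiK] : {psi : gT -> 'I_n * bool * bool | {in G, cancel psi dicyclic_elt}}.
  have n_gt0 : (0 < n)%N by lia.
  pose d := (Ordinal n_gt0, false, false).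
  exists (fun g => odflt d [pick p | dicyclic_elt p == g]) => g Gg.
  case: pickP => [p /eqP //|no].
  have : g \in <[x]> <*> <[y]> by rewrite defG.
  move=> /(subsetP dicyclic_joinE) /imsetP[p _ gE].
  by have := no p; rewrite gE eqxx.
have eltK : cancel dicyclic_elt psi.
  by move=> p; apply: dicyclic_elt_inj; rewrite psiK.
have centE p : (dicyclic_elt p \in G :\: 'Z(G)) = dicyclic_noncentral p.
  rewrite !inE eltG andbT /=; apply/idP/idP.
    apply: contraR; rewrite negb_or negbK => /andP[/negPf p2 /eqP p0].
    apply/centP => g Gg; rewrite -(psiK _ Gg); apply/eqP.
    by rewrite dicyclic_commute p2 p0; case: (psi g).2.
  move=> nc; apply/negP => /centP cG.
  have n_gt0 : (0 < n)%N by lia.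
  (* An element that does not commute with [p]: x if [p] involves y, and y if [p] is a noncentral
     power of x. *)
  pose q := if p.2 then (Ordinal n_gt1, false, false) else (Ordinal n_gt0, false, true).
  have /eqP := cG _ (eltG q); rewrite dicyclic_commute /q.
  by move: nc; rewrite /dicyclic_noncentral; case: (p.2) => //= /negPf ->.
pose f (u : noncommuting_graph G) := dicyclic_class (psi (val u)).
have uG (u : noncommuting_graph G) : val u \in G.
  by case: u => g /=; rewrite inE => /andP[].
have cardf c : #|[set u | f u == c]| =
    #|[set p | dicyclic_noncentral p & dicyclic_class p == c]|.
  rewrite -(card_imset _ val_inj) -[RHS](card_imset _ dicyclic_elt_inj).
  apply: eq_card => g; apply/imsetP/imsetP => [[u]|[p]].
    rewrite inE => fu ->; exists (psi (val u)); last by rewrite psiK.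
    by rewrite inE fu andbT -centE psiK ?(valP u).
  rewrite inE -centE => /andP[nc cp ->].
  by exists (exist _ (dicyclic_elt p) nc : noncentral G); rewrite ?inE /f /= ?eltK.
exists f; split.
- move=> u v; rewrite /= /noncommuting; congr (~~ _).
  have ncE (w : noncommuting_graph G) : dicyclic_noncentral (psi (val w)).
    by rewrite -centE psiK ?(valP w).
  rewrite -{1 2}(psiK _ (uG u)) -{1 2}(psiK _ (uG v)) dicyclic_commute /f.
  move: (ncE u) (ncE v); rewrite /dicyclic_noncentral /dicyclic_class.
  (* The remaining cases pair a power of x with an element involving y; noncentrality of the power
     rules out that they commute. *)
  case: (psi (val u)) => [[i a] []]; case: (psi (val v)) => [[j b] []] //=.
  - by move=> _ /negPf ->.
  by move=> /negPf ->.
- by rewrite cardf card_dicyclic_class0.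
by move=> c; rewrite cardf card_dicyclic_class_lift.
Qed.

End DicyclicRelations.

(** * From the presentation to the graph, and conclusion *)

Lemma noncommuting_graph_dicyclic n (gT : finGroupType) (G : {group gT}) :
  (1 < n)%N ->
  (G \isog Grp (x : y : x ^+ (2 * n) = y ^+ 4 = 1, x ^+ n = y ^+ 2,
             y^-1 * x * y = x^-1)) ->
  exists f : noncommuting_graph G -> 'I_n.+1,
  [/\ forall u v, adj u v = (f u != f v),
      #|[set u | f u == ord0]| = (2 * n - 2)%N &
      forall c, #|[set u | f u == lift ord0 c]| = 2%N].
Proof.
move=> n_gt1 isoG; have [H [homH cardH]] := dicyclic_perm_model n_gt1.
(* Every group with two generators satisfying the relations is a homomorphic image of [G], so the
   permutation model bounds its order from below. *)
have G_ge : (4 * n <= #|G|)%N.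
  by apply: leq_trans cardH (leq_homg _); rewrite isoG.
have /existsP[[x y]] := isoGrp_hom isoG.
rewrite /= !xpair_eqE => /and5P[/eqP defG /eqP x2n _ /eqP xn /eqP xJ].
apply: (dicyclic_multipartite n_gt1 x2n xn _ _ defG); last by rewrite defG.
by rewrite conjgE mulgA.
Qed.

Local Close Scope group_scope.

Theorem theorem2p13 (R : rcfType) (n : nat) (hn : (2 <= n)%N)
    (gT : finGroupType) (G : {group gT})
    (hG : (G \isog Grp (x : y :
             x ^+ (2 * n) = y ^+ 4 = 1, x ^+ n = y ^+ 2,
             y^-1 * x * y = x^-1))%g) :
  let N : R := n%:R in
  let r : R := Num.sqrt (8 * N ^+ 2 - 16 * N + 9) in
  perm_eq (signless_laplacian_spectrum R (noncommuting_graph G))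
    (nseq n (4 * N - 4) ++ nseq (2 * n - 3) (2 * N) ++ nseq (n - 1) (4 * N - 6)
       ++ nseq 1 (4 * N - 3 + r) ++ nseq 1 (4 * N - 3 - r))
  /\ signless_laplacian_energy R (noncommuting_graph G) =
       if (n <= 4)%N
       then (4 * N ^+ 3 - 8 * N ^+ 2 + 6) / (2 * N - 1) + 2 * r
       else (8 * N ^+ 3 - 32 * N ^+ 2 + 32 * N - 6) / (2 * N - 1) + 2 * r.
Proof.
move=> N r; have [f [adjE card0 card_lift]] := noncommuting_graph_dicyclic hn hG.
split; first exact: (dicyclic_spectrum R hn adjE card0 card_lift).
exact: (dicyclic_energy R hn adjE card0 card_lift).
Qed.
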